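(* Let $\mathbb{F}$ be a field, let $T$ be a finite tree, let $M\in\mathcal{M}_{\mathbb{F},0}(T)$, and let $v\in\mathrm{Supp}(M)$. Then for every vector $\vec{x}\in\mathbb{F}^{V(T)}$, we have $\vec{x}\in\mathrm{Null}(M)$ if and only if $D^{(M,v)}\vec{x}\in\mathrm{Null}(A(T))$, where $D^{(M,v)}$ is the $v$-scalation of $M$.
   Context: All graphs are finite, undirected, without loops or multiple edges. $\mathbb{F}$ is an arbitrary field. For a graph $G$, $\mathcal{M}_{\mathbb{F},0}(G)$ is the set of all (not necessarily symmetric) matrices $M$ over $\mathbb{F}$ with rows and columns indexed by $V(G)$, with all diagonal entries zero, and such that for distinct $u,w\in V(G)$ the entry $M_{u,w}$ is nonzero if and only if $\{u,w\}\in E(G)$. $A(G)$ is the adjacency matrix of $G$, viewed as a $(0,1)$-matrix over $\mathbb{F}$. $\mathrm{Null}(M)=\{\vec{x}\in\mathbb{F}^{V(G)}: M\vec{x}=0\}$. The null support $\mathrm{Supp}(M)$ is the set of vertices $w\in V(G)$ such that some $\vec{x}\in\mathrm{Null}(M)$ has $\vec{x}_w\neq 0$. For a tree $T$ and $v,w\in V(T)$, $vPw$ denotes the unique directed path from $v$ to $w$ in $T$; $(a,b)\in vPw$ means that $a,b$ are consecutive vertices of this path with $a$ preceding $b$ (traversing from $v$ to $w$). For $M\in\mathcal{M}_{\mathbb{F},0}(T)$ and $v\in V(T)$, the $v$-scalation of $M$ is the non-singular diagonal matrix $D^{(M,v)}$, indexed by $V(T)$, with $$D^{(M,v)}_{w,w}=\prod_{\substack{(u,t)\in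 vPw\\ u\in\mathrm{Supp}(M)}}M_{t,u}^{-1}\ \prod_{\substack{(t,u)\in vPw\\ u\in\mathrm{Supp}(M)}}M_{t,u},$$ where empty products equal $1$ (so $D^{(M,v)}_{v,v}=1$). *)

(* Defs.v *)
From HB Require Import structures.
From mathcomp Require Import all_boot all_order all_algebra.
From mathcomp Require Import boolp.

Set Implicit Arguments.
Unset Strict Implicit.
Unset Printing Implicit Defensive.

Import GRing.Theory.
Local Open Scope ring_scope.

(* The vertex set is 'I_n, so that matrices indexed by the vertices are
   MathComp's 'M_n and vectors indexed by the vertices are 'cV_n. *)
Record sgraph (n : nat) := SGraph {
  edge :> rel 'I_n;
  edge_sym : symmetric edge;
  edge_irrefl : irreflexive edge
}.

Definition is_connected (n : nat) (G : sgraph n) : Prop :=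
  (0 < n)%N /\ forall u w : 'I_n, connect G u w.

(* Cycles have at least 3 vertices: [:: u; w] satisfies ucycle whenever
   u and w are adjacent. *)
Definition is_acyclic (n : nat) (G : sgraph n) : Prop :=
  forall c : seq 'I_n, (2 < size c)%N -> ~ ucycle G c.

Definition is_tree (n : nat) (G : sgraph n) : Prop :=
  is_connected G /\ is_acyclic G.

(* v :: p is a path with pairwise distinct vertices ending at w. *)
Definition simple_path (n : nat) (G : sgraph n) (v w : 'I_n) (p : seq 'I_n) :=
  [&& path G v p, last v p == w & uniq (v :: p)].

(* The vertices following v on a simple path from v to w (v itself is omitted).
   The length bound n loses nothing, because v :: p is duplicate-free; the
   default [::] is only taken when w is not reachable from v.  In a tree the
   choice is unique, see tree_pathP. *)
Definition tree_path (n : nat) (G : sgraph n) (v w : 'I_n) : seq 'I_n :=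
  if [pick p : {bseq n of 'I_n} | simple_path G v w p] is Some p then p
  else [::].

(* The pairs (a, b) of consecutive vertices of the path from v to w, with a
   preceding b. *)
Definition path_arcs (n : nat) (G : sgraph n) (v w : 'I_n) :
    seq ('I_n * 'I_n) :=
  zip (v :: tree_path G v w) (tree_path G v w).

Definition in_M0 (F : fieldType) (n : nat) (G : sgraph n) (M : 'M[F]_n) : Prop :=
  (forall u, M u u = 0) /\ (forall u w, u != w -> (M u w != 0 <-> G u w)).

Definition adj_mx (F : fieldType) (n : nat) (G : sgraph n) : 'M[F]_n :=
  \matrix_(u, w) (G u w)%:R.

Definition Null (F : fieldType) (n : nat) (M : 'M[F]_n) : {pred 'cV[F]_n} :=
  [pred x : 'cV[F]_n | M *m x == 0].

Definition Supp (F : fieldType) (n : nat) (M : 'M[F]_n) : {set 'I_n} :=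
  [set w | `[< exists2 x : 'cV[F]_n, x \in Null M & x w 0 != 0 >]].

(* In both products the factor is M_(t,u) or its inverse, where u is the
   endpoint of the arc lying in Supp M and t is the other endpoint; the arc is
   (u, t) in the first product and (t, u) in the second. *)
Definition scalation (F : fieldType) (n : nat) (G : sgraph n) (M : 'M[F]_n)
    (v : 'I_n) : 'M[F]_n :=
  diag_mx (\row_w
    ((\prod_(a <- path_arcs G v w | a.1 \in Supp M) (M a.2 a.1)^-1)
     * \prod_(a <- path_arcs G v w | a.2 \in Supp M) M a.1 a.2)).

Lemma simple_path_uniq (n : nat) (G : sgraph n) (v w : 'I_n) (p q : seq 'I_n) :
  is_acyclic G -> simple_path G v w p -> simple_path G v w q -> p = q.
Proof.
move=> acG; elim: p v q => [|a p IHp] v [|b q] //.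
- case/and3P=> _ /= /eqP<- _ /and3P[_ /eqP Eq] /andP[].
  by rewrite -{1}Eq /= mem_last.
- case/and3P=> _ /= /eqP Ep /andP[vp _] /and3P[_ /= /eqP vw _].
  by move: vp; rewrite vw -Ep mem_last.
case/and3P=> /= /andP[va pp] /eqP lp /andP[vp up].
case/and3P=> /= /andP[vb pq] /eqP lq /andP[vq uq].
case: (eqVneq a b) vq uq pq lq vb => [<-|ab] vq uq pq lq vb.
  by congr cons; apply: (IHp a); rewrite /simple_path /= ?pp ?pq ?lp ?lq ?eqxx.
case: (acG (v :: a :: shorten a (p ++ rev (belast b q)))) => //.
all: have lr : last a (p ++ rev (belast b q)) = b.
all: try by rewrite last_cat lp -lq; case: (q) => //= c s; rewrite rev_cons last_rcons.
all: have pr : path G a (p ++ rev (belast b q)).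
all: try by rewrite cat_path pp lp -lq rev_path; apply: sub_path pq => x y /=; rewrite edge_sym.
all: case: (shortenP pr) lr => s ps us ss ls.
  by case: s ls {ps us ss} => //= ab'; rewrite ab' eqxx in ab.
rewrite /ucycle /= va rcons_path ps ls edge_sym vb /=.
move: us; rewrite /= => ->; rewrite andbT.
apply: contra (vp); rewrite inE => /orP[/eqP->|/ss]; first exact: mem_head.
rewrite mem_cat => /orP[vp'|]; first by rewrite inE vp' orbT.
by rewrite mem_rev => /mem_belast vbq; rewrite vbq in vq.
Qed.

Lemma tree_pathP (n : nat) (G : sgraph n) (v w : 'I_n) (p : seq 'I_n) :
  is_tree G -> simple_path G v w p <-> p = tree_path G v w.
Proof.
move=> [[_ cG] acG]; suff tP : simple_path G v w (tree_path G v w).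
  by split=> [sp|-> //]; apply: simple_path_uniq sp tP.
rewrite /tree_path; case: pickP => [q //|] no.
have /connectP[q pq lq] := cG v w; case: (shortenP pq) lq => s ps us _ ls.
have sn : (size s <= n)%N.
  by rewrite -[X in (_ <= X)%N]card_ord ltnW // -[(size s).+1]/(size (v :: s)) -(card_uniqP us) max_card.
by have := no (Bseq sn); rewrite /simple_path /= ps -ls eqxx; move: us => /= ->.
Qed.

(* Main.v *)
Require Import Defs.
From mathcomp Require Import all_boot all_order all_algebra.
From mathcomp Require Import boolp.

Set Implicit Arguments.
Unset Strict Implicit.
Unset Printing Implicit Defensive.

Import GRing.Theory.
Local Open Scope ring_scope.

(** Rooting the tree at [v], one solves [M t u = d1 t * d2 u] edge by edge, so
    that [M] is an invertible diagonal rescaling of the adjacency matrix [A] on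
    both sides; hence [Supp M = Supp A].  Moreover [Supp A] is independent:
    since a tree is bipartite, for adjacent [u] and [w] in [Supp A] there are
    null vectors [x], [y] with [x u != 0], [x w = 0], [y w != 0], [y u = 0], and
    summing [y A x - x A y] over the component of [u] in [T - uw] gives
    [y u * x w = x u * y w], a contradiction.  Now the scalation satisfies
    [D u = D t * M t u] for each edge [tu] with [u] in the support and [t]
    outside, and on vectors vanishing outside the independent set [Supp M] this
    turns the equations of [M] into those of [A]. *)

(** If [b] is off the path to [a], the edge extends that path. Otherwise the path splits at [b], and
    its second part is a simple path from [b] to [a], hence the edge alone by uniqueness. *)
Lemma tree_path_edge (n : nat) (T : sgraph n) (v a b : 'I_n) :
  is_tree T -> T a b ->
  tree_path T v b = rcons (tree_path T v a) b \/
  tree_path T v a = rcons (tree_path T v b) a.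
Proof.
move=> treeT ab.
have /and3P[pa /eqP la ua] : simple_path T v a (tree_path T v a).
  by apply/tree_pathP.
case bP: (b \in v :: tree_path T v a); last first.
  left; symmetry; apply/tree_pathP => //.
  rewrite /simple_path rcons_path pa la ab last_rcons eqxx.
  by rewrite -rcons_cons rcons_uniq bP ua.
right; case/splitPl: bP pa la ua => p q lp.
rewrite cat_path lp -cat_cons cat_uniq last_cat lp => /andP[pp pq] lq.
move=> /and3P[up pNq uq].
have -> : tree_path T v b = p.
  by symmetry; apply/tree_pathP => //; rewrite /simple_path pp lp eqxx.
rewrite -cats1; congr cat.
apply: (@simple_path_uniq _ T b a); first by case: treeT.
  rewrite /simple_path pq lq eqxx /= uq andbT.
  apply: contra pNq => bq; apply/hasP; exists b => //=.
  by rewrite -lp mem_last.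
rewrite /simple_path /= edge_sym ab eqxx /= andbT inE.
by apply: contraTneq ab => ->; rewrite edge_irrefl.
Qed.

Lemma path_arcs_edge (n : nat) (T : sgraph n) (v a b : 'I_n) :
  is_tree T -> T a b ->
  path_arcs T v b = rcons (path_arcs T v a) (a, b) \/
  path_arcs T v a = rcons (path_arcs T v b) (b, a).
Proof.
move=> treeT ab.
(* [zip] drops the last entry of its longer first list, which is [c]; appending [d] pairs that entry
   with [d]. *)
have zipr c d : tree_path T v d = rcons (tree_path T v c) d ->
    path_arcs T v d = rcons (path_arcs T v c) (c, d).
  move=> tE; rewrite /path_arcs tE.
  have /and3P[_ /eqP lc _] : simple_path T v c (tree_path T v c).
    by apply/tree_pathP.
  move: (tree_path T v c) lc => {tE} s.
  elim: s (v) => [|e s IHs] r /=; first by move->.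
  by move=> /IHs <-.
by case: (tree_path_edge v treeT ab) => /zipr; [left | right].
Qed.

Lemma path_arcs_are_edges (n : nat) (T : sgraph n) (v w : 'I_n) :
  is_tree T -> all (fun a => T a.1 a.2) (path_arcs T v w).
Proof.
move=> treeT.
have /and3P[+ _ _] : simple_path T v w (tree_path T v w).
  by apply/tree_pathP.
rewrite /path_arcs; move: (tree_path T v w) => s.
elim: s (v) => //= b s IHs r.
by case/andP=> -> /IHs.
Qed.

Lemma tree_bipartite (n : nat) (T : sgraph n) :
  is_tree T -> exists c : 'I_n -> bool, forall a b, T a b -> c b = ~~ c a.
Proof.
move=> treeT; case: n T treeT => [|n] T treeT.
  by exists (fun=> true) => -[].
(* The colour is the parity of the distance to the root [ord0]. *)
exists (fun a => odd (size (tree_path T ord0 a))) => a b ab.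
by case: (tree_path_edge ord0 treeT ab) => ->; rewrite size_rcons /= ?negbK.
Qed.

(* [C] is the component of [u] in the tree minus the edge [uw]. *)
Lemma tree_cut_edge (n : nat) (T : sgraph n) (u w : 'I_n) :
  is_tree T -> T u w ->
  exists2 C : {set 'I_n}, u \in C /\ w \notin C &
    forall a b, T a b -> a \in C -> b \notin C -> a = u /\ b = w.
Proof.
move=> [_ acT] uw.
pose uw_arc (a b : 'I_n) := (a == u) && (b == w) || (a == w) && (b == u).
pose e : rel 'I_n := [rel a b | T a b && ~~ uw_arc a b].
have wNu : w != u by apply: contraTneq uw => ->; rewrite edge_irrefl.
(* A simple path from [u] to [w] in [e] is also one in [T], so it is the edge itself, which [e]
   excludes. *)
have Nuw : ~~ connect e u w.
  apply/negP => /connectP[p pp lp].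
  case: (shortenP pp) lp => s ps us _ ls.
  have : s = [:: w].
    apply: (simple_path_uniq acT (v := u) (w := w)).
      rewrite /simple_path us -ls eqxx !andbT.
      by apply: sub_path ps => a b /andP[].
    by rewrite /simple_path /= uw eqxx /= andbT inE eq_sym.
  by move=> sE; move: ps; rewrite sE /= /e /= /uw_arc !eqxx andbF.
exists [set a | connect e u a]; first by rewrite !inE connect0.
move=> a b ab; rewrite !inE => ua ubN.
have : uw_arc a b.
  apply: contraNT ubN => Nab; apply: connect_trans ua (connect1 _).
  by rewrite /e /= ab.
case/orP=> /andP[/eqP aE /eqP bE] //.
by move: ua; rewrite aE (negPf Nuw).
Qed.

Lemma M0_edge (F : fieldType) (n : nat) (T : sgraph n) (M : 'M[F]_n) t u :
  in_M0 T M -> T t u = (M t u != 0).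
Proof.
move=> [M0 M1]; case: (eqVneq t u) => [<-|tu].
  by rewrite edge_irrefl M0 eqxx.
by apply/idP/idP => /M1; apply.
Qed.

Lemma adj_mx_M0 (F : fieldType) (n : nat) (T : sgraph n) :
  in_M0 T (adj_mx F T).
Proof.
split=> [u|u w _]; rewrite mxE; first by rewrite edge_irrefl.
by case: (T u w); rewrite ?oner_eq0 ?eqxx.
Qed.

Lemma mem_NullP (F : fieldType) (n : nat) (M : 'M[F]_n) (x : 'cV[F]_n) :
  x \in Null M <-> forall t, \sum_u M t u * x u 0 = 0.
Proof.
split=> [/eqP Mx t|Mx].
  by move/colP: Mx => /(_ t); rewrite !mxE.
by apply/eqP/colP => t; rewrite !mxE.
Qed.

Lemma SuppP (F : fieldType) (n : nat) (M : 'M[F]_n) (w : 'I_n) :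
  reflect (exists2 x : 'cV[F]_n, x \in Null M & x w 0 != 0) (w \in Supp M).
Proof. by rewrite inE; apply: asboolP. Qed.

Lemma Null_notin_Supp (F : fieldType) (n : nat) (M : 'M[F]_n) x w :
  x \in Null M -> w \notin Supp M -> x w 0 = 0.
Proof.
by move=> xM; apply: contraNeq => xw; apply/SuppP; exists x.
Qed.

Lemma M0_diag_equiv (F : fieldType) (n : nat) (T : sgraph n) (M : 'M[F]_n) :
  is_tree T -> in_M0 T M ->
  exists d : 'I_n -> F * F, (forall a, (d a).1 != 0 /\ (d a).2 != 0) /\
    forall a b, M a b = (d a).1 * adj_mx F T a b * (d b).2.
Proof.
move=> treeT M_T; case: n T M treeT M_T => [|n] T M treeT M_T.
  by exists (fun=> (1, 1)); split=> [] [].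
(* From the pair [z] at [a.1], the pair at [a.2] is forced by the factorisations of the two entries
   [M a.2 a.1] and [M a.1 a.2]. *)
pose step (z : F * F) (a : 'I_n.+1 * 'I_n.+1) :=
  (M a.2 a.1 / z.2, M a.1 a.2 / z.1).
pose d a := foldl step (1, 1) (path_arcs T ord0 a).
have d_nz a : (d a).1 != 0 /\ (d a).2 != 0.
  have := path_arcs_are_edges ord0 a treeT; rewrite /d.
  elim/last_ind: (path_arcs _ _ _) => [|s c IHs].
    by rewrite /= oner_eq0.
  rewrite all_rcons foldl_rcons => /andP[ce /IHs[s1 s2]] /=.
  rewrite !mulf_neq0 ?invr_eq0 //.
    by rewrite -(M0_edge _ _ M_T).
  by rewrite -(M0_edge _ _ M_T) edge_sym.
exists d; split=> // a b; rewrite mxE.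
case abE: (T a b); last first.
  rewrite mulr0 mul0r; apply/eqP.
  by move: abE; rewrite (M0_edge _ _ M_T) => /negbFE.
rewrite mulr1; have [a1 a2] := d_nz a; have [b1 b2] := d_nz b.
case: (path_arcs_edge ord0 treeT abE) => pE.
  have -> : d b = step (d a) (a, b) by rewrite /d pE foldl_rcons.
  by rewrite /= mulrC divfK.
have -> : d a = step (d b) (b, a) by rewrite /d pE foldl_rcons.
by rewrite /= divfK.
Qed.

(** The left diagonal factor preserves null vectors; the right one only rescales their coordinates
    by nonzero scalars. *)
Lemma Supp_adj (F : fieldType) (n : nat) (T : sgraph n) (M : 'M[F]_n) :
  is_tree T -> in_M0 T M -> Supp M = Supp (adj_mx F T).
Proof.
move=> treeT /(M0_diag_equiv treeT)[d [d_nz dE]].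
apply/setP => w; apply/SuppP/SuppP => -[x /mem_NullP xN xw].
  exists (\col_a ((d a).2 * x a 0)); last by rewrite mxE mulf_neq0 ?(d_nz w).2.
  apply/mem_NullP => t; apply: (mulfI (d_nz t).1).
  rewrite mulr0 -[RHS](xN t) mulr_sumr; apply: eq_bigr => u _.
  by rewrite dE !mxE !mulrA.
exists (\col_a ((d a).2^-1 * x a 0)).
  apply/mem_NullP => t; rewrite -[RHS](mulr0 (d t).1) -[in RHS](xN t) mulr_sumr.
  apply: eq_bigr => u _.
  by rewrite dE !mxE -!mulrA (mulVKf (d_nz u).2).
by rewrite mxE mulf_neq0 ?invr_eq0 ?(d_nz w).2.
Qed.

Lemma Null_adj_cross (F : fieldType) (n : nat) (T : sgraph n) x y u w :
  is_tree T -> T u w -> x \in Null (adj_mx F T) -> y \in Null (adj_mx F T) ->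
  y u 0 * x w 0 = x u 0 * y w 0.
Proof.
move=> treeT uw xN yN.
have [C [uC wC] cutC] := tree_cut_edge treeT uw.
pose S (y x : 'cV[F]_n) :=
  \sum_(a in C) \sum_(b in C) y a 0 * (adj_mx F T a b * x b 0).
(* The rows in [C] annihilate [x'], and the only edge leaving [C] is [uw]. *)
have SE x' y' : x' \in Null (adj_mx F T) -> S y' x' + y' u 0 * x' w 0 = 0.
  move=> /mem_NullP x'N.
  have <- : \sum_(a in C) y' a 0 * \sum_b adj_mx F T a b * x' b 0 = 0.
    by apply: big1 => a _; rewrite x'N mulr0.
  have -> : y' u 0 * x' w 0
      = \sum_(a in C) \sum_(b | b \notin C) y' a 0 * (adj_mx F T a b * x' b 0).
    rewrite (bigD1 u) //= (bigD1 w) //= mxE uw mul1r !big1 ?addr0 //.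
      move=> a /andP[aC au]; apply: big1 => b bC; rewrite mxE.
      case ab: (T a b); last by rewrite mul0r mulr0.
      by have [aE _] := cutC _ _ ab aC bC; rewrite aE eqxx in au.
    move=> b /andP[bC bw]; rewrite mxE.
    case ub: (T u b); last by rewrite mul0r mulr0.
    by have [_ bE] := cutC _ _ ub uC bC; rewrite bE eqxx in bw.
  rewrite /S -big_split; apply: eq_bigr => a _ /=.
  by rewrite mulr_sumr [RHS](bigID (mem C)).
have SC : S y x = S x y.
  rewrite /S exchange_big; apply: eq_bigr => a _; apply: eq_bigr => b _.
  by rewrite !mxE (edge_sym T b) mulrA mulrC [y b 0 * _]mulrC.
by apply: (addrI (S y x)); rewrite SE // SC SE.
Qed.

Lemma Supp_adj_independent (F : fieldType) (n : nat) (T : sgraph n) u w :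
  is_tree T -> T u w -> u \in Supp (adj_mx F T) -> w \notin Supp (adj_mx F T).
Proof.
move=> treeT uw /SuppP[x xN xu]; apply/negP => /SuppP[y yN yw].
have [c cE] := tree_bipartite treeT.
(* Each row of the adjacency matrix meets a single colour class, so restricting a null vector to one
   class leaves it null. *)
pose half k (z : 'cV[F]_n) : 'cV[F]_n := \col_a (if c a == k then z a 0 else 0).
have half_Null k z : z \in Null (adj_mx F T) -> half k z \in Null (adj_mx F T).
  move=> /mem_NullP zN; apply/mem_NullP => t.
  case: (eqVneq (c t) k) => [tk|tk].
    apply: big1 => a _; rewrite !mxE; case ta: (T t a); last by rewrite mul0r.
    by rewrite (cE _ _ ta) -tk; case: (c t); rewrite mulr0.
  rewrite -[RHS](zN t); apply: eq_bigr => a _; rewrite !mxE.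
  case ta: (T t a); last by rewrite !mul0r.
  by rewrite (cE _ _ ta); case: (c t) k tk => [] [].
have := Null_adj_cross treeT uw (half_Null (c u) x xN) (half_Null (c w) y yN).
rewrite !mxE !eqxx (cE _ _ uw).
have -> : (~~ c u == c u) = false by case: (c u).
by move/eqP; rewrite mulr0 eq_sym mulf_eq0 (negPf xu) (negPf yw).
Qed.

(** The paths from [v] to [t] and [u] differ by one last arc. It contributes [M t u] to the entry at
    [u] if [u] comes last, and the inverse to the entry at [t] if [t] does. *)
Lemma scalation_edge (F : fieldType) (n : nat) (T : sgraph n) (M : 'M[F]_n)
    (v t u : 'I_n) : is_tree T -> in_M0 T M -> T t u ->
  t \notin Supp M -> u \in Supp M ->
  scalation T M v u u = scalation T M v t t * M t u.
Proof.
move=> treeT M_T tu tS uS; rewrite !mxE !eqxx !mulr1n.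
have Mtu : M t u != 0 by rewrite -(M0_edge _ _ M_T).
case: (path_arcs_edge v treeT tu) => ->.
  by rewrite !big_rcons /= (negPf tS) uS mulr1 mulrA.
by rewrite !big_rcons /= (negPf tS) uS mulr1 mulrAC divfK.
Qed.

Lemma scalation_neq0 (F : fieldType) (n : nat) (T : sgraph n) (M : 'M[F]_n)
    (v w : 'I_n) : is_tree T -> in_M0 T M -> scalation T M v w w != 0.
Proof.
move=> treeT M_T; rewrite !mxE eqxx mulr1n.
rewrite mulf_neq0 // prodf_seq_neq0.
all: apply: sub_all (path_arcs_are_edges v w treeT) => -[a b] /= ab.
all: by apply/implyP => _; rewrite ?invr_eq0 -(M0_edge _ _ M_T) // edge_sym.
Qed.

Theorem theorem4 (F : fieldType) (n : nat) (T : sgraph n) (M : 'M[F]_n)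
    (v : 'I_n) (T_tree : is_tree T) (M_T : in_M0 T M) (v_supp : v \in Supp M) :
  forall x : 'cV[F]_n,
    x \in Null M <-> scalation T M v *m x \in Null (adj_mx F T).
Proof.
move=> x; set D := scalation T M v.
have D_nz w : D w w != 0 by apply: scalation_neq0.
have DxE w : (D *m x) w 0 = D w w * x w 0.
  by rewrite /D /scalation mul_diag_mx !mxE eqxx mulr1n.
(* Only the terms with [u] in the support survive; by independence each neighbour [t] of such a [u]
   lies outside, so [scalation_edge] applies. *)
have row_eq : (forall u, u \notin Supp M -> x u 0 = 0) -> forall t,
    \sum_u adj_mx F T t u * (D *m x) u 0 = D t t * \sum_u M t u * x u 0.
  move=> x0 t; rewrite mulr_sumr; apply: eq_bigr => u _; rewrite DxE.
  have [uS|/x0->] := boolP (u \in Supp M); last by rewrite !mulr0.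
  rewrite [adj_mx F T t u]mxE; case tu: (T t u); last first.
    move: tu; rewrite (M0_edge _ _ M_T) => /negbFE/eqP->.
    by rewrite !mul0r mulr0.
  have tS : t \notin Supp M.
    move: uS; rewrite (Supp_adj T_tree M_T).
    by apply: Supp_adj_independent; rewrite // edge_sym.
  by rewrite mul1r mulrA -scalation_edge.
split=> xN; have xP := xN; move/mem_NullP: xP => xP; apply/mem_NullP => t.
  by rewrite row_eq ?xP ?mulr0 // => u; apply: Null_notin_Supp.
(* Here the vanishing of [x] off [Supp M] is read off from [D *m x], since both matrices have the
   same support and [D] has nonzero diagonal. *)
apply: (mulfI (D_nz t)); rewrite mulr0 -row_eq // => u.
rewrite (Supp_adj T_tree M_T) => /(Null_notin_Supp xN)/eqP.
by rewrite DxE mulf_eq0 (negPf (D_nz u)) => /eqP.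
Qed.
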